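(* For a partition $\lambda$ with at most $n$ parts, \[ G_\lambda(x_1,\dots,x_n;\boldsymbol\alpha,\boldsymbol\beta)=C_n\det\Big(h_{\lambda_i-i+j}\big[X_n\ominus(A_{\lambda_i}-B_{i-1}+B_j)\big]\Big)_{i,j=1}^n,\qquad C_n=\prod_{i,j=1}^n(1-\beta_ix_j). \]
   Context: $A_k=\alpha_1+\dots+\alpha_k$, $B_k=\beta_1+\dots+\beta_k$ for $k\ge1$, $A_k=B_k=0$ for $k\le0$; $X_n=x_1+\dots+x_n$. For a formal $\mathbb Z$-linear combination $Z=\sum_uc_uu$ of variables/parameters, $\sum_{m\ge0}h_m[Z]t^m=\prod_u(1-ut)^{-c_u}$, $h_m[Z]=0$ for $m<0$; for two such combinations $Y,W$ and any integer $m$, $h_m[Y\ominus W]=\sum_{a,b\ge0,\,a-b=m}h_a[Y]h_b[W]$. $G_\lambda(x_1,\dots,x_n;\boldsymbol\alpha,\boldsymbol\beta)=\det\big(x_j^{\lambda_i+n-i}\prod_{k=1}^{i-1}(1-\beta_kx_j)/\prod_{k=1}^{\lambda_i}(1-\alpha_kx_j)\big)_{i,j=1}^n/\prod_{1\le i<j\le n}(x_i-x_j)$. *)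

(* Defs.v *)
From HB Require Import structures.
From mathcomp Require Import all_boot all_order all_algebra finmap fraction.
From mathcomp Require Import mathcomp_extra boolp classical_sets functions.
From mathcomp Require Import cardinality fsbigop.
From mathcomp Require Import monalg.

Set Implicit Arguments.
Unset Strict Implicit.
Unset Printing Implicit Defensive.

Import Order.TTheory GRing.Theory Num.Theory.

Local Open Scope classical_set_scope.
Local Open Scope ring_scope.

(** A formal power series in R[[V]] is an arbitrary R-valued function on the finitely supported
    monomials {cmonom V}; coefficients at monomials are plain applications. *)

Record mpseries (V : countType) (R : Type) := MPSeries {
  pscoef :> {cmonom V} -> R }.

Section Basics.
Variables (V : countType) (R : Type).

Lemma mpseriesP (f g : mpseries V R) : (forall m, f m = g m) <-> f = g.
Proof.
split=> [|->//]; case: f g => [f] [g] /= fg.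
by congr MPSeries; apply/funext.
Qed.

HB.instance Definition _ := gen_eqMixin (mpseries V R).
HB.instance Definition _ := gen_choiceMixin (mpseries V R).
End Basics.

Definition divisor_pairs (V : countType) (m : {cmonom V}) :
    set ({cmonom V} * {cmonom V}) := [set p | mmul p.1 p.2 = m].

(** Monomials embed multiplicatively in the positive integers: the k-th variable goes to the k-th prime; used to show that a monomial has
    finitely many divisors and that R[[V]] is a domain. *)

Section MonomialNumber.
Variable V : countType.
Implicit Types m : {cmonom V}.

Fixpoint nthprime (k : nat) : nat :=
  if k is k'.+1 then s2val (prime_above (nthprime k')) else 2.

Lemma nthprime_prime k : prime (nthprime k).
Proof. by case: k => [|k] //=; case: prime_above. Qed.

Lemma nthprime_lt : {homo nthprime : i j / (i < j)%N}.
Proof. by apply: homo_ltn ltn_trans _ => i /=; case: prime_above. Qed.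

Lemma nthprime_inj : injective nthprime.
Proof.
move=> i j eq_ij.
by case: (ltngtP i j) => // /nthprime_lt; rewrite eq_ij ltnn.
Qed.

Definition monnum m : nat :=
  (\prod_(v <- finsupp m) nthprime (choice.pickle v) ^ m v)%N.

Lemma monnum_wide m (d : {fset V}) : (finsupp m `<=` d)%fset ->
  monnum m = (\prod_(v <- d) nthprime (choice.pickle v) ^ m v)%N.
Proof.
move=> le; rewrite /monnum (big_fset_incl _ le) // => v _.
by rewrite -cmE_neq0 negbK => /eqP ->.
Qed.

Lemma monnumM m1 m2 : monnum (mmul m1 m2) = (monnum m1 * monnum m2)%N.
Proof.
rewrite (monnum_wide (fsubsetUl (finsupp m1) (finsupp m2))).
rewrite (monnum_wide (fsubsetUr (finsupp m1) (finsupp m2))).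
rewrite /monnum mdomD -big_split /=.
by apply: eq_bigr => v _; rewrite cmM expnD.
Qed.

Lemma monnum_gt0 m : (0 < monnum m)%N.
Proof.
rewrite /monnum prodn_gt0 // => v.
by rewrite expn_gt0 prime_gt0 ?nthprime_prime.
Qed.

Lemma logn_monnum m v : logn (nthprime (choice.pickle v)) (monnum m) = m v.
Proof.
pose d := ([fset v] `|` finsupp m)%fset.
rewrite (@monnum_wide m d) ?fsubsetUr // (big_fsetD1 v) ?fset1U1 //=.
have p_gt0 w : (0 < nthprime (choice.pickle w) ^ m w)%N.
  by rewrite expn_gt0 prime_gt0 ?nthprime_prime.
rewrite lognM //; last by rewrite prodn_gt0.
rewrite pfactorK ?nthprime_prime // [X in (_ + X)%N](_ : _ = 0%N) ?addn0 //.
rewrite big_seq_cond; elim/big_ind: _ => [||w].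
- by rewrite logn1.
- move=> x y x0 y0; case: (posnP x) => [->|xp]; first by rewrite mul0n logn0.
  by case: (posnP y) => [->|yp]; rewrite ?muln0 ?logn0 // lognM // x0 y0.
rewrite andbT !inE => /andP[wv _]; rewrite lognX logn_prime ?nthprime_prime //.
case: eqP => [/nthprime_inj/(pcan_inj choice.pickleK) vw|]; last by rewrite muln0.
by rewrite vw eqxx in wv.
Qed.

Lemma monnum_inj : injective monnum.
Proof.
move=> m1 m2 eq12; apply/eqP/cmP => v.
by rewrite -(logn_monnum m1) eq12 logn_monnum.
Qed.

Lemma finite_divisor_pairs m : finite_set (divisor_pairs m).
Proof.
pose f (p : {cmonom V} * {cmonom V}) := (monnum p.1, monnum p.2).
pose B := `I_(monnum m).+1 `*` `I_(monnum m).+1.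
apply: (@sub_finite_set _ _ (f @^-1` B)); last first.
  apply: finite_preimage; last by apply: finite_setX; exact: finite_II.
  by move=> [a b] [c d] _ _ [/monnum_inj-> /monnum_inj->].
move=> [a b]; rewrite /divisor_pairs /= => abm.
rewrite /B /f /= -abm monnumM !ltnS.
by split; [apply: leq_pmulr|apply: leq_pmull]; exact: monnum_gt0.
Qed.

Lemma mmulI m : injective (mmul m).
Proof.
move=> m1 m2 /(congr1 monnum); rewrite !monnumM => /eqP.
by rewrite eqn_pmul2l ?monnum_gt0 // => /eqP/monnum_inj.
Qed.

End MonomialNumber.

Section Zmodule.
Variables (V : countType) (R : zmodType).
Implicit Types f g : mpseries V R.

Definition pszero : mpseries V R := MPSeries (fun _ => 0).
Definition psopp f : mpseries V R := MPSeries (fun m => - f m).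
Definition psadd f g : mpseries V R := MPSeries (fun m => f m + g m).

Fact psaddA : associative psadd.
Proof. by move=> f g h; apply/mpseriesP => m /=; rewrite addrA. Qed.
Fact psaddC : commutative psadd.
Proof. by move=> f g; apply/mpseriesP => m /=; rewrite addrC. Qed.
Fact psadd0 : left_id pszero psadd.
Proof. by move=> f; apply/mpseriesP => m /=; rewrite add0r. Qed.
Fact psaddN : left_inverse pszero psopp psadd.
Proof. by move=> f; apply/mpseriesP => m /=; rewrite addNr. Qed.

HB.instance Definition _ := GRing.isZmodule.Build (mpseries V R)
  psaddA psaddC psadd0 psaddN.

(** Coefficientwise sum of a family.  As \sum_(i \in A) is 0 when infinitely
    many terms are nonzero, this is the sum of the family only when each
    monomial occurs in finitely many of its members. *)
Definition pssum (I : choiceType) (A : set I) (F : I -> mpseries V R) :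
  mpseries V R := MPSeries (fun m => \sum_(i \in A) F i m).

End Zmodule.

Section Ring.
Variables (V : countType) (R : comNzRingType).
Implicit Types (f g h : mpseries V R) (m : {cmonom V}).

Definition psC (c : R) : mpseries V R :=
  MPSeries (fun m => c *+ (m == mone)).

Definition psvar (v : V) : mpseries V R :=
  MPSeries (fun m => (m == ucm v)%:R).

Definition psmul f g : mpseries V R :=
  MPSeries (fun m => \sum_(p \in divisor_pairs m) f p.1 * g p.2).

Lemma psmul_malg f g (p q : {malg R[{cmonom V}]}) m :
  (forall a b, mmul a b = m -> f a = p@_a /\ g b = q@_b) ->
  psmul f g m = (p * q)@_m.
Proof.
move=> fpgq; rewrite mcoeffMl /=.
pose s := [seq (a, b) | a <- enum_fset (msupp p), b <- enum_fset (msupp q)].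
pose r := [seq x <- s | mmul x.1 x.2 == m].
have memr x : x \in r = [&& mmul x.1 x.2 == m, x.1 \in msupp p & x.2 \in msupp q].
  rewrite mem_filter; congr (_ && _); case: x => a b /=.
  by apply/allpairsP/andP => [[[c d] /= [? ? [-> ->]]]|[? ?]] //; exists (a, b).
have ur : uniq r.
  by rewrite filter_uniq // allpairs_uniq ?fset_uniq // => -[? ?] [? ?].
rewrite /psmul /= (fsbigE r) //; last 2 first.
- by move=> x /=; rewrite memr => /and3P[/eqP].
- move=> x xm; have [-> ->] := fpgq _ _ xm.
  rewrite memr xm eqxx /= negb_and => /orP[] /mcoeff_outdom ->.
    by rewrite mul0r.
  by rewrite mulr0.
rewrite big_filter_cond /= big_mkcond /= big_allpairs_dep /=.
apply: eq_bigr => a _; apply: eq_bigr => b _.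
case: eqP => [abm|] /=; last by rewrite mulr0n.
by rewrite mem_set //; have [-> ->] := fpgq _ _ abm; rewrite mulr1n.
Qed.

Definition mdivisors m : {fset {cmonom V}} :=
  fset_set [set a | exists b, mmul a b = m].

Lemma in_mdivisors m a b : mmul a b = m -> a \in mdivisors m.
Proof.
move=> abm; rewrite in_fset_set; first by apply/mem_set; exists b.
apply: (@sub_finite_set _ _ (fst @` divisor_pairs m)); last first.
  by apply: finite_image; exact: finite_divisor_pairs.
by move=> c [d cdm]; exists (c, d).
Qed.

Definition pstrunc m f : {malg R[{cmonom V}]} := [malg a in mdivisors m => f a].

Lemma pstruncE m f a b : mmul a b = m -> (pstrunc m f)@_a = f a.
Proof. by move=> /in_mdivisors am; rewrite mcoeffE am. Qed.

Fact psmulC : commutative psmul.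
Proof.
move=> f g; apply/mpseriesP => m.
rewrite (@psmul_malg f g (pstrunc m f) (pstrunc m g)); last first.
  by move=> a b abm; rewrite (pstruncE f abm) (@pstruncE m g b a) // mulmC.
rewrite (@psmul_malg g f (pstrunc m g) (pstrunc m f)) 1?mulrC //.
by move=> a b abm; rewrite (pstruncE g abm) (@pstruncE m f b a) // mulmC.
Qed.

Fact psmulA : associative psmul.
Proof.
move=> f g h; apply/mpseriesP => m; pose T := pstrunc m.
have TE (k : mpseries V R) a b c : mmul (mmul a b) c = m -> k b = (T k)@_b.
  by rewrite [mmul a b]mulmC -mulmA => /pstruncE ->.
rewrite (@psmul_malg f _ (T f) (T g * T h)); last first.
  move=> a b abm; rewrite (pstruncE f abm); split=> //.
  apply: psmul_malg => c d cdb; rewrite -cdb in abm.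
  by rewrite (TE g a c d) ?(TE h (mmul a c) d mone) ?mulm1 -?mulmA.
rewrite (@psmul_malg _ h (T f * T g) (T h)) 1?mulrA //.
move=> a b abm; rewrite (TE h a b mone) ?mulm1 //; split=> //.
apply: psmul_malg => c d cda; rewrite -cda in abm.
by rewrite (TE g c d b) ?(TE f mone c (mmul d b)) ?mul1m ?mulmA.
Qed.

Fact psmul1 : left_id (psC 1) psmul.
Proof.
move=> f; apply/mpseriesP => m.
rewrite (@psmul_malg _ f 1 (pstrunc m f)); last first.
  move=> a b abm; rewrite mcoeff1 (@pstruncE m f b a) 1?mulmC //.
rewrite mul1r (@pstruncE m f m mone) // mulm1 //.
Qed.

Fact psmulDl : left_distributive psmul +%R.
Proof.
move=> f g h; apply/mpseriesP => m /=.
rewrite -fsbig_split; last exact: finite_divisor_pairs.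
by apply: eq_fsbigr => p _ /=; rewrite mulrDl.
Qed.

Fact psone_neq0 : psC 1 != 0.
Proof.
apply/eqP => /mpseriesP/(_ mone)/eqP /=.
by rewrite eqxx mulr1n oner_eq0.
Qed.

HB.instance Definition _ := GRing.Zmodule_isComNzRing.Build (mpseries V R)
  psmulA psmulC psmul1 psmulDl psone_neq0.

(** The units are the invertible series, by definition. *)
Definition psunit : {pred mpseries V R} := [pred f | `[< exists g, g * f = 1 >]].

Definition psinv f : mpseries V R :=
  if pselect (exists g, g * f = 1) is left ex then projT1 (cid ex) else f.

Fact psmulV : {in psunit, left_inverse 1 psinv *%R}.
Proof.
move=> f /asboolP ex; rewrite /psinv; case: pselect => // ex'.
by case: cid.
Qed.

Fact psunitP f g : g * f = 1 -> psunit f.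
Proof. by move=> gf; apply/asboolP; exists g. Qed.

Fact psinv_out : {in [predC psunit], psinv =1 id}.
Proof.
move=> f /negP nuf; rewrite /psinv; case: pselect => // ex.
by case: nuf; apply/asboolP.
Qed.

HB.instance Definition _ := GRing.ComNzRing_hasMulInverse.Build (mpseries V R)
  psmulV psunitP psinv_out.

End Ring.

Section Domain.
Variables (V : countType) (R : idomainType).
Implicit Types f g : mpseries V R.

Lemma psmin f : f != 0 -> exists m,
  f m != 0 /\ forall m', f m' != 0 -> (monnum m <= monnum m')%N.
Proof.
move=> f0; pose P n := `[< exists m, monnum m = n /\ f m != 0 >].
have exP : exists n, P n.
  suff [m fm] : exists m, f m != 0 by exists (monnum m); apply/asboolP; exists m.
  apply: contrapT => /forallNP f0'; move/eqP: f0; apply; apply/mpseriesP => m.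
  by apply/eqP; apply: contrapT => /negP; exact: f0'.
case: (ex_minnP exP) => n /asboolP[m [<- fm]] min; exists m; split=> // m' fm'.
by apply: min; apply/asboolP; exists m'.
Qed.

Fact ps_integral : GRing.integral_domain_axiom (mpseries V R).
Proof.
move=> f g fg0; apply/norP => -[/psmin[a [fa mina]] /psmin[b [gb minb]]].
have /eqP : (f * g) (mmul a b) = 0 by rewrite fg0.
apply/negP; rewrite /= (fsbigE [:: (a, b)]) //=.
- rewrite big_cons big_nil mem_set // addr0 mulf_neq0 //.
- by move=> x /=; rewrite inE => /eqP ->.
move=> [c d] /= cdab; rewrite inE xpair_eqE => ncd.
apply/eqP; apply: contraNT ncd; rewrite mulf_eq0 negb_or => /andP[fc gd].
have /(congr1 (@monnum V)) := cdab; rewrite !monnumM => eqn.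
have leac := mina _ fc; have lebd := minb _ gd.
have eac : a = c.
  apply: monnum_inj; apply/eqP; rewrite eqn_leq leac leqNgt /=.
  apply/negP => ltac; move/eqP: eqn; rewrite gtn_eqF //.
  apply: (@leq_trans (monnum c * monnum b)); last by rewrite leq_mul2l lebd orbT.
  by rewrite ltn_pmul2r // monnum_gt0.
by rewrite -{1}eac eqxx -(@mmulI _ c d b) ?eqxx // -[in RHS]eac.
Qed.

HB.instance Definition _ := GRing.ComUnitRing_isIntegral.Build (mpseries V R)
  ps_integral.

End Domain.

Inductive symbol := SymX of nat | SymAlpha of nat | SymBeta of nat.

Definition symbol_code (s : symbol) : nat + nat + nat :=
  match s with
  | SymX k => inl (inl k) | SymAlpha k => inl (inr k) | SymBeta k => inr k
  end.

Definition symbol_decode (s : nat + nat + nat) : symbol :=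
  match s with
  | inl (inl k) => SymX k | inl (inr k) => SymAlpha k | inr k => SymBeta k
  end.

Fact symbol_codeK : cancel symbol_code symbol_decode.
Proof. by case. Qed.

HB.instance Definition _ := Countable.copy symbol (can_type symbol_codeK).

Notation series := (mpseries symbol int).

(** Subscripts start at 1, as usual; the symbols of subscript 0 are unused. *)
Definition x_ (k : nat) : series := psvar int (SymX k).
Definition alpha_ (k : nat) : series := psvar int (SymAlpha k).
Definition beta_ (k : nat) : series := psvar int (SymBeta k).

Notation combination := {malg int[symbol]}.

Definition sumX (n : nat) : combination := \sum_(1 <= k < n.+1) << SymX k >>.
Definition sumA (n : nat) : combination := \sum_(1 <= k < n.+1) << SymAlpha k >>.
Definition sumB (n : nat) : combination := \sum_(1 <= k < n.+1) << SymBeta k >>.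

(** The variable t is the only inhabitant tt of unit. *)
Notation tseries := (mpseries unit series).

Definition genh (Z : combination) : tseries :=
  \prod_(u <- msupp Z) (1 - psC unit (psvar int u) * psvar series tt) ^ (- Z@_u).

Definition hsym (m : int) (Z : combination) : series :=
  if m is Posz k then genh Z (expcmn (ucm tt) k) else 0.

(** h_m[Y (-) W], summed over the pairs (a, b) of naturals with a - b = m.  For
    all Y and W the family is coefficientwise finite, the (a, b) term being
    homogeneous of degree a + b. *)
Definition hominus (m : int) (Y W : combination) : series :=
  pssum [set p : nat * nat | p.1%:Z - p.2%:Z = m]
        (fun p => hsym p.1 Y * hsym p.2 W).

Definition is_partition (lam : seq nat) : bool := sorted geq lam && (0%N \notin lam).

(** Parts are numbered from 1. *)
Definition part (lam : seq nat) (i : nat) : nat := nth 0%N lam i.-1.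

Notation "f %:F" := (@FracField.tofrac _ f) : ring_scope.

(** Rows and columns are numbered from 0 by 'I_n: the usual i and j are here
    i.+1 and j.+1.  The entries are power series, as 1 - alpha_k x_j is a unit;
    only the quotient by the Vandermonde product is formed in the fraction
    field. *)
Definition Groth (n : nat) (lam : seq nat) : {fraction series} :=
  (\det (\matrix_(i < n, j < n)
     (x_ j.+1 ^+ (part lam i.+1 + n - i.+1)
      * \prod_(1 <= k < i.+1) (1 - beta_ k * x_ j.+1)
      / \prod_(1 <= k < (part lam i.+1).+1) (1 - alpha_ k * x_ j.+1))))%:F
  / (\prod_(i < n) \prod_(j < n | (i < j)%N) (x_ i.+1 - x_ j.+1))%:F.

Definition prefactor (n : nat) : series :=
  \prod_(1 <= i < n.+1) \prod_(1 <= j < n.+1) (1 - beta_ i * x_ j).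

(* Main.v *)
(** The sums [h_m[X_n (-) W]] obey two recursions: removing a letter [u] from
    [X_n] subtracts [u] times the value at [m - 1], and removing [u] from [W]
    subtracts [u] times the value at [m + 1].  Removing letters is thus the action
    on the index [m] of the polynomials [prod (T - u)] and [prod (1 - u T)], where
    [T] shifts [m].  Acting on [W] gives a unitriangular column operation that
    replaces every [B_j] by [B_n].  Acting on [X_n] to leave a single letter [x_k]
    multiplies the resulting matrix by the matrix of coefficients of
    [prod_(l <> k) (T - x_l)], whose determinant is the Vandermonde product, and
    produces the matrix with entries [x_k^(lam_i + n - i) H_W(x_k)], where
    [W = A_(lam_i) - B_(i-1) + B_n] and [H_W(t) = sum_m h_m[W] t^m].  Up to the column factors
    [prod_l (1 - beta_l x_k)] this is the matrix that defines [G_lambda]. *)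

Require Import Defs.
From mathcomp Require Import all_boot all_order all_algebra fraction monalg.
From mathcomp Require Import finmap zify ring classical_sets fsbigop.

Import GRing.Theory.
Local Open Scope ring_scope.

(** * Coefficients of power series and the filtration by total degree *)

Section SeriesCoefficients.
Context {V : countType} {R : comNzRingType}.
Implicit Types (f g : mpseries V R) (m : {cmonom V}).

Lemma pscoefD f g m : (f + g) m = f m + g m. Proof. by []. Qed.

Lemma pscoefN f m : (- f) m = - f m. Proof. by []. Qed.

Lemma pscoef_sum (I : Type) (r : seq I) (P : pred I) (F : I -> mpseries V R) m :
  (\sum_(i <- r | P i) F i) m = \sum_(i <- r | P i) F i m.
Proof. by elim/big_rec2: _ => // i y g _ <-. Qed.

Lemma pscoef_psC c f m : (psC V c * f) m = c * f m.
Proof.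
rewrite /= (fsbigE [:: (mone, m)]) //=.
- by rewrite big_cons big_nil mem_set /= ?addr0 /divisor_pairs /= ?mul1m ?eqxx.
- by move=> p /=; rewrite inE => /eqP ->; rewrite /divisor_pairs /= mul1m.
move=> [a b] /=; rewrite /divisor_pairs inE xpair_eqE /= => <-.
by have [->|_] := eqVneq a mone; rewrite ?mul1m ?eqxx // mulr0n mul0r.
Qed.

Lemma pscoef_psvar v f m : (psvar R v * f) (mmul (ucm v) m) = f m.
Proof.
rewrite /= (fsbigE [:: (ucm v, m)]) //=.
- by rewrite big_cons big_nil mem_set //= eqxx mul1r addr0.
- by move=> p /=; rewrite inE => /eqP ->.
move=> [a b] /=; rewrite /divisor_pairs inE xpair_eqE /= => abm.
have [av|] := eqVneq a (ucm v); last by rewrite mul0r.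
by move: abm; rewrite av => /mmulI ->; rewrite eqxx.
Qed.

Lemma pscoef_psvar1 v f : (psvar R v * f) mone = 0.
Proof.
rewrite /= fsbig1 // => -[a b]; rewrite /divisor_pairs /= => /eqP.
rewrite cmM_eq1 => /andP[/eqP-> _].
by rewrite eq_sym cm1_eq1 mul0r.
Qed.

(** By [ordge_eq] this filtration is separated, so identities between infinite sums can be checked
    on finite truncations. *)
Definition ordge (k : nat) f := forall m, (mdeg m < k)%N -> f m = 0.

Lemma ordge0 f : ordge 0 f. Proof. by []. Qed.

Lemma ordgeD k f g : ordge k f -> ordge k g -> ordge k (f + g).
Proof. by move=> fk gk m mk; rewrite pscoefD fk ?gk ?addr0. Qed.

Lemma ordgeN k f : ordge k f -> ordge k (- f).
Proof. by move=> fk m mk; rewrite pscoefN fk ?oppr0. Qed.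

Lemma ordgeM j k f g : ordge j f -> ordge k g -> ordge (j + k) (f * g).
Proof.
move=> fj gk m mjk; rewrite /= fsbig1 // => -[a b]; rewrite /divisor_pairs /= => abm.
have [/fj ->|ja] := ltnP (mdeg a) j; first by rewrite mul0r.
rewrite [g b]gk ?mulr0 //; move: mjk; rewrite -abm mdegM; lia.
Qed.

Lemma ordge_psvar v : ordge 1 (psvar R v).
Proof.
move=> m /=; rewrite ltnS leqn0 mdeg_eq0 => /eqP ->.
by rewrite eq_sym cm1_eq1.
Qed.

Lemma ordge_eq f g : (forall k, ordge k (f - g)) -> f = g.
Proof.
move=> fg; apply/mpseriesP => m.
by apply/eqP; rewrite -subr_eq0; apply/eqP/(fg (mdeg m).+1).
Qed.

End SeriesCoefficients.

(** * The generating series in [t] and the recursion for [h_m] *)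

Section TCoef.
Implicit Types (F : tseries) (f : series) (Z : combination) (u : symbol).

Definition tcoef F k : series := F (expcmn (ucm tt) k).

Lemma expcmnS k : expcmn (ucm tt) k.+1 = mmul (ucm tt) (expcmn (ucm tt) k).
Proof. by case: k => [|k] //=; rewrite mulm1. Qed.

Lemma tcoefP F G : tcoef F =1 tcoef G -> F = G.
Proof.
move=> FG; apply/mpseriesP => m.
suff -> : m = expcmn (ucm tt) (m tt) by apply: FG.
apply/eqP/cmP => -[]; elim: (m tt) => [|k IHk]; first by rewrite cm1.
by rewrite expcmnS cmM -IHk cmU eqxx.
Qed.

Definition linfactor f : tseries := 1 - psC unit f * psvar series tt.

Lemma tcoef_linfactor0 f F : tcoef (linfactor f * F) 0 = tcoef F 0.
Proof.
rewrite /tcoef mulrBl mul1r -mulrA pscoefD pscoefN pscoef_psC.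
by rewrite pscoef_psvar1 mulr0 subr0.
Qed.

Lemma tcoef_linfactorS f F k :
  tcoef (linfactor f * F) k.+1 = tcoef F k.+1 - f * tcoef F k.
Proof.
rewrite /tcoef mulrBl mul1r -mulrA pscoefD pscoefN pscoef_psC.
by rewrite expcmnS pscoef_psvar.
Qed.

Lemma tcoef1 k : tcoef 1 k = (k == 0%N)%:R.
Proof.
case: k => [|k]; first by rewrite /tcoef /= eqxx.
by rewrite /tcoef expcmnS /= cmM_eq1 cm1_eq1.
Qed.

Lemma linfactor_unit f : linfactor f \is a GRing.unit.
Proof.
(* The inverse of [1 - f t] is the geometric series. *)
pose G : tseries := MPSeries (fun m : {cmonom unit} => f ^+ m tt).
have GE k : tcoef G k = f ^+ k.
  rewrite /tcoef /=; congr (_ ^+ _).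
  by elim: k => [|k IHk]; rewrite ?cm1 // expcmnS cmM cmU IHk.
apply/unitrPr; exists G; apply: tcoefP => -[|k].
  by rewrite tcoef_linfactor0 GE tcoef1.
by rewrite tcoef_linfactorS !GE tcoef1 -exprS subrr.
Qed.

Definition symfactor u : tseries := linfactor (psvar int u).

(** Lets the products for [Z] and [Z - << u >>] run over one common index set, although their
    supports may differ. *)
Lemma genhE (d : {fset symbol}) Z : (msupp Z `<=` d)%fset ->
  genh Z = \prod_(u <- d) symfactor u ^ (- Z@_u).
Proof.
move=> Zd; apply: big_fset_incl => // u _ /mcoeff_outdom ->.
by rewrite oppr0 expr0z.
Qed.

Lemma genhB Z u : genh (Z - << u >>) = symfactor u * genh Z.
Proof.
have [d [ud Zd ZBd]] : exists d : {fset symbol},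
    [/\ u \in d, (msupp Z `<=` d)%fset & (msupp (Z - << u >>) `<=` d)%fset].
  exists ([fset u] `|` msupp Z)%fset; rewrite fsubsetUr !inE eqxx; split=> //.
  by rewrite (fsubset_trans (msuppB_le _ _)) // fsetUC msuppU oner_eq0.
have expB (c : int) : symfactor u ^ (- (c - 1)) =
    symfactor u * symfactor u ^ (- c).
  by rewrite opprB exprzDr ?linfactor_unit // expr1z.
rewrite (genhE _ _ Zd) (genhE _ _ ZBd) (big_fsetD1 u ud) [in RHS](big_fsetD1 u ud) /=.
rewrite (eq_big_seq (fun v => symfactor v ^ (- Z@_v))) => [|v].
  by move: (\prod_(v <- _) _) => P; rewrite mcoeffB mcoeffUU expB mulrA.
rewrite !inE /= => /andP[/negPf vu _].
have ZE : (Z - << u >>)@_v = Z@_v by rewrite mcoeffB mcoeffU eq_sym vu subr0.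
exact (congr1 (fun c => symfactor v ^ (- c)) ZE).
Qed.

(** Compare coefficients of [t^m] in [genhB]; the convention that negative indices give 0 covers the
    boundary case [m = 0]. *)
Lemma hsymB m Z u :
  hsym m (Z - << u >>) = hsym m Z - psvar int u * hsym (m - 1) Z.
Proof.
case: m => [[|k]|k] /=; rewrite ?genhB.
- by rewrite mulr0 subr0 [LHS]tcoef_linfactor0.
- by rewrite [LHS]tcoef_linfactorS /= subn1.
by rewrite mulr0 subr0.
Qed.

Lemma hsym0 (m : int) : hsym m 0 = (m == 0)%:R.
Proof.
case: m => // k /=; rewrite /genh msupp0 big_seq_fset0 [LHS]tcoef1.
by rewrite eqz_nat.
Qed.

(** Coefficients may have either sign, so the inductive step is an equivalence: letters get added as
    well as removed. *)
Lemma combination_ind (P : combination -> Prop) :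
  P 0 -> (forall Z u, P (Z - << u >>) <-> P Z) -> forall Z, P Z.
Proof.
move=> P0 PB Z; suff H W : P W -> P (W + Z) by rewrite -[Z]add0r; apply: H.
rewrite [Z]monalgE; elim: (enum_fset _) W => [|u r IHr] W PW.
  by rewrite big_nil addr0.
rewrite big_cons addrA; apply: IHr.
have PD Y : P (Y + << u >>) <-> P Y by rewrite -(PB (Y + _) u) addrK.
suff PM Y k : P (Y + << k *g u >>) <-> P Y by apply/PM.
elim: k Y => [|k IHk|k IHk] Y.
- by rewrite monalgU0 addr0.
- by rewrite intS monalgUD addrA IHk PD.
by rewrite intS opprD monalgUD monalgUN addrA IHk PB.
Qed.

(** The half of the homogeneity of [h_k] that makes the tails of the sums [hominus] small. *)
Lemma ordge_hsym (k : nat) Z : ordge k (hsym k Z).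
Proof.
elim/combination_ind: Z k => [k|Z u].
  by rewrite hsym0 eqz_nat; case: k => [|k] //= m _; rewrite mulr0n.
have step k : ordge k (hsym k Z) ->
    ordge k.+1 (psvar int u * hsym (k.+1%:Z - 1) Z).
  by move=> Zk; rewrite -add1n /= subn1; apply: ordgeM Zk; apply: ordge_psvar.
split=> H; last first.
  by case=> [//|k]; rewrite hsymB; apply: ordgeD => //; apply/ordgeN/step.
(* Adding a letter back requires induction on [k]: [h_(k+1)[Z]] differs from [h_(k+1)[Z - u]] by [u
   h_k[Z]]. *)
elim=> [//|k IHk]; have := H k.+1; rewrite hsymB => /ordgeD/(_ (step _ IHk)).
by rewrite subrK.
Qed.

End TCoef.

(** * The two recursions for [h_m[Y (-) W]] *)

Section Hominus.
Implicit Types (Y W Z : combination) (u : symbol) (m : int).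

(** The pair is determined by [b], as [a = m + b]; terms with [m + b] negative vanish because [hsym]
    does. *)
Definition hominus_trunc N m Y W : series :=
  \sum_(b < N) hsym (m + b%:Z) Y * hsym b W.

(** A dropped term has [b >= N], hence [a = m + b >= k], and its factor [h_a[Y]] alone already has
    order at least [k]. *)
Lemma hominus_truncP k N m Y W : k%:Z <= m + N%:Z ->
  ordge k (hominus m Y W - hominus_trunc N m Y W).
Proof.
move=> kmN mu muk; rewrite pscoefD pscoefN pscoef_sum.
apply/eqP; rewrite subr_eq0; apply/eqP.
pose r := [seq (absz (m + b%:Z), b) | b <- iota 0 N & 0 <= m + b%:Z].
rewrite [LHS]/= (fsbigE r) /=; first last.
- move=> [a b] /= abm abr; case: (ltnP b N) => [bN|Nb].
    case/negP: abr; apply/mapP; exists b; last by congr (_, _); lia.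
    by rewrite mem_filter mem_iota; lia.
  have/ordgeM/(_ (@ordge0 _ _ (hsym b W))) := @ordge_hsym a Y.
  by apply; lia.
- by move=> _ /= /mapP[b + ->]; rewrite mem_filter /= => /andP[? _]; lia.
- by rewrite map_inj_uniq ?filter_uniq ?iota_uniq // => b c [].
rewrite big_map big_filter_cond -(big_mkord xpredT (fun b =>
  (hsym (m + b%:Z) Y * hsym b W) mu)) /index_iota subn0.
rewrite [RHS](bigID (fun b : nat => 0 <= m + b%:Z)) /= [X in _ = _ + X]big1.
  rewrite addr0; apply: eq_big => b.
    have [mb|//] := boolP (0 <= m + b%:Z); apply/mem_set => /=; lia.
  by case: (m + b%:Z) => // c; rewrite andbF.
move=> b; case: (m + b%:Z) => // c _ /=.
by rewrite fsbig1 // => p _; rewrite mul0r.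
Qed.

Lemma hominusBl m Y u W :
  hominus m (Y - << u >>) W = hominus m Y W - psvar int u * hominus (m - 1) Y W.
Proof.
(* Large enough that both [m + N] and [m - 1 + N] are at least [k]. *)
apply: ordge_eq => k; pose N := (k + `|m|.+1)%N.
have T0 := @hominus_truncP k N m (Y - << u >>) W.
have T1 := @hominus_truncP k N m Y W.
have T2 := @hominus_truncP k N (m - 1) Y W.
have Ttrunc : hominus_trunc N m (Y - << u >>) W =
    hominus_trunc N m Y W - psvar int u * hominus_trunc N (m - 1) Y W.
  rewrite /hominus_trunc mulr_sumr -sumrB; apply: eq_bigr => b _.
  by rewrite hsymB mulrBl -mulrA addrAC.
rewrite (_ : _ - _ = (hominus m (Y - << u >>) W - hominus_trunc N m (Y - << u >>) W)
  - (hominus m Y W - hominus_trunc N m Y W)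
  + psvar int u * (hominus (m - 1) Y W - hominus_trunc N (m - 1) Y W)); last first.
  by rewrite Ttrunc; ring.
apply: ordgeD; first by apply: ordgeD; [apply: T0|apply/ordgeN/T1]; lia.
by rewrite -[k]add0n; apply: ordgeM => //; apply: T2; lia.
Qed.

Lemma hominusBr m Y u W :
  hominus m Y (W - << u >>) = hominus m Y W - psvar int u * hominus (m + 1) Y W.
Proof.
apply: ordge_eq => k; pose N := (k + `|m|.+1)%N.
have T0 := @hominus_truncP k N.+1 m Y (W - << u >>).
have T1 := @hominus_truncP k N.+1 m Y W.
have T2 := @hominus_truncP k N (m + 1) Y W.
have Ttrunc : hominus_trunc N.+1 m Y (W - << u >>) =
    hominus_trunc N.+1 m Y W - psvar int u * hominus_trunc N (m + 1) Y W.
  (* The term [b = 0] vanishes since [h_(-1) = 0]; reindexing the rest turns [m] into [m + 1] and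
     the length [N.+1] into [N]. *)
  have shift : \sum_(b < N.+1) hsym (m + b%:Z) Y * hsym (b%:Z - 1) W =
      hominus_trunc N (m + 1) Y W.
    rewrite big_ord_recl mulr0 add0r; apply: eq_bigr => b _; rewrite lift0.
    have -> : b.+1%:Z - 1 = b by lia.
    by have -> : m + b.+1%:Z = m + 1 + b%:Z by lia.
  rewrite -shift mulr_sumr -sumrB; apply: eq_bigr => b _.
  by rewrite hsymB mulrBr mulrCA.
rewrite (_ : _ - _ = (hominus m Y (W - << u >>) - hominus_trunc N.+1 m Y (W - << u >>))
  - (hominus m Y W - hominus_trunc N.+1 m Y W)
  + psvar int u * (hominus (m + 1) Y W - hominus_trunc N (m + 1) Y W)); last first.
  by rewrite Ttrunc; ring.
apply: ordgeD; first by apply: ordgeD; [apply: T0|apply/ordgeN/T1]; lia.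
by rewrite -[k]add0n; apply: ordgeM => //; apply: T2; lia.
Qed.

Lemma hominus0l m W : 0 < m -> hominus m 0 W = 0.
Proof.
move=> m0; apply/mpseriesP => mu; rewrite /= fsbig1 // => -[a b] /= abm.
have -> : genh 0 (expcmn (ucm tt) a) = 0.
  by rewrite -[LHS]/(hsym a 0) hsym0; case: eqP => //; lia.
by rewrite fsbig1 // => p _; rewrite mul0r.
Qed.

Lemma hominus0r m Y : hominus m Y 0 = hsym m Y.
Proof.
apply: ordge_eq => k; pose N := (k + `|m|)%N.
have := @hominus_truncP k N.+1 m Y 0.
rewrite /hominus_trunc big_ord_recl big1 => [|b _]; last first.
  by rewrite hsym0 lift0 mulr0.
by rewrite hsym0 !addr0 mulr1; apply; lia.
Qed.

End Hominus.

(** * Polynomials acting on integer-indexed sequences, with ['X] as the shift *)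

Section ShiftAction.
Context {R : comNzRingType}.
Implicit Types (p : {poly R}) (f : int -> R) (m : int).

Definition shiftact p f m : R := \sum_(j < size p) p`_j * f (m + j%:Z).

(** Pads the sum to a fixed length, so that it can be read as an entry of a matrix product. *)
Lemma shiftactE N p f m : (size p <= N)%N ->
  shiftact p f m = \sum_(j < N) p`_j * f (m + j%:Z).
Proof.
move=> pN; rewrite /shiftact (big_ord_widen N (fun j => p`_j * f (m + j%:Z))) //.
rewrite [RHS](bigID (fun j : 'I_N => (j < size p)%N)) /=.
rewrite [X in _ = _ + X]big1 ?addr0 // => j.
by rewrite -leqNgt => /leq_sizeP -> //; rewrite mul0r.
Qed.

Lemma shiftact1 f m : shiftact 1 f m = f m.
Proof. by rewrite (shiftactE 1) ?size_poly1 // big_ord1 coef1 mul1r addr0. Qed.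

Lemma shiftactB p (q : {poly R}) f m :
  shiftact (p - q) f m = shiftact p f m - shiftact q f m.
Proof.
pose N := maxn (size p) (size q).
have pqN : (size (p - q)%R <= N)%N by rewrite (leq_trans (size_polyD _ _)) ?size_polyN.
rewrite !(shiftactE N) ?leq_maxl ?leq_maxr // -sumrB.
by apply: eq_bigr => j _; rewrite coefB mulrBl.
Qed.

Lemma shiftactCM c p f m : shiftact (c%:P * p) f m = c * shiftact p f m.
Proof.
rewrite mul_polyC !(shiftactE (size p)) ?size_scale_leq // mulr_sumr.
by apply: eq_bigr => j _; rewrite coefZ mulrA.
Qed.

Lemma shiftactXM p f m : shiftact ('X * p) f m = shiftact p f (m + 1).
Proof.
rewrite (shiftactE (size p).+1); last first.
  by rewrite (leq_trans (size_polyMleq _ _)) // size_polyX.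
rewrite big_ord_recl coefXM mul0r add0r; apply: eq_bigr => j _.
by rewrite coefXM lift0 /= intS addrA.
Qed.

Lemma shiftact_XBC c p f m :
  shiftact (('X - c%:P) * p) f m = shiftact p f (m + 1) - c * shiftact p f m.
Proof. by rewrite mulrBl shiftactB shiftactXM shiftactCM. Qed.

Lemma shiftact_1BCX c p f m :
  shiftact ((1 - c%:P * 'X) * p) f m = shiftact p f m - c * shiftact p f (m + 1).
Proof. by rewrite mulrBl mul1r -mulrA shiftactB shiftactCM shiftactXM. Qed.

Lemma shiftactXnM k p f m : shiftact ('X^k * p) f m = shiftact p f (m + k%:Z).
Proof.
elim: k m => [|k IHk] m; first by rewrite expr0 mul1r addr0.
by rewrite exprS -mulrA shiftactXM IHk intS addrA.
Qed.

End ShiftAction.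

(** * Removing several letters at once *)

Section HominusShift.
Variables (I : Type) (S : I -> symbol).
Implicit Types (Y W : combination) (r : seq I) (m : int).

Let s_ i := psvar int (S i).

(** At index [m + 1], [hominusBl] is the action of ['X - u] at [m]; each removed letter thus costs
    one unit of the index. *)
Lemma hominus_subl m Y W r :
  hominus (m + (size r)%:Z) (Y - \sum_(i <- r) << S i >>) W =
  shiftact (\prod_(i <- r) ('X - (s_ i)%:P)) (fun k => hominus k Y W) m.
Proof.
elim: r m => [|i r IHr] m; first by rewrite addr0 !big_nil subr0 shiftact1.
rewrite !big_cons [<< _ >> + _]addrC opprD addrA hominusBl.
rewrite shiftact_XBC -!IHr /= intS addrA.
by rewrite [m + 1 + _]addrAC addrK.
Qed.

Lemma hominus_subr m Y W r :
  hominus m Y (W - \sum_(i <- r) << S i >>) =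
  shiftact (\prod_(i <- r) (1 - (s_ i)%:P * 'X)) (fun k => hominus k Y W) m.
Proof.
elim: r m => [|i r IHr] m; first by rewrite !big_nil subr0 shiftact1.
rewrite !big_cons [<< _ >> + _]addrC opprD addrA hominusBr !IHr.
by rewrite shiftact_1BCX.
Qed.

End HominusShift.

(** * Sums in a single letter, where [hominus 0 << v >> W] is [H_W(v)] *)

Section HominusVar.
Implicit Types (u v : symbol) (W : combination).

(** Removing [v] leaves the empty combination, whose sums vanish at positive index, so the sequence
    is geometric with ratio [v]. *)
Lemma hominus_var (k : nat) v W :
  hominus k << v >> W = psvar int v ^+ k * hominus 0 << v >> W.
Proof.
elim: k => [|k IHk]; first by rewrite mul1r.
have := hominusBl k.+1 << v >> v W; rewrite subrr hominus0l //.
rewrite intS [1 + _]addrC addrK IHk => /eqP.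
by rewrite eq_sym subr_eq0 exprS mulrA => /eqP.
Qed.

(** The shift from index 0 to 1 is multiplication by [v], so removing [u] from [W] contributes the
    factor [1 - u v]. *)
Lemma hominus_var0_sub (I : Type) (S : I -> symbol) (r : seq I) v W :
  hominus 0 << v >> (W - \sum_(i <- r) << S i >>) =
  \prod_(i <- r) (1 - psvar int (S i) * psvar int v) * hominus 0 << v >> W.
Proof.
elim: r => [|i r IHr]; first by rewrite !big_nil subr0 mul1r.
rewrite !big_cons [<< _ >> + _]addrC opprD addrA hominusBr.
rewrite add0r (hominus_var 1) IHr expr1.
move: (psvar int v) (psvar int (S i)) (hominus 0 _ W) (\prod_(j <- r) _) => a b H P.
by rewrite mulrBl mul1r mulrBl !mulrA.
Qed.

Lemma hominus_var00 v : hominus 0 << v >> 0 = 1.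
Proof.
by rewrite hominus0r; have := hsymB 0 << v >> v; rewrite subrr hsym0 mulr0 subr0.
Qed.

End HominusVar.

(** * The determinant of the Lagrange coefficient matrix *)

Section VandermondeInverse.
Variables (R : idomainType) (n : nat) (a : 'I_n -> R).

(* The columns are the coefficients of the unnormalized Lagrange polynomials, so
   up to column scaling this is the inverse of the transposed Vandermonde matrix. *)
Lemma det_lagrange_coefs : injective a ->
  \det (\matrix_(j < n, k < n) (\prod_(l | l != k) ('X - (a l)%:P))`_j) =
  \prod_(i < n) \prod_(j < n | (i < j)%N) (a i - a j).
Proof.
move=> a_inj; set E := (X in \det X).
pose V := (Vandermonde n (\row_i a i))^T.
have VE : V *m E = diag_mx (\row_k \prod_(l | l != k) (a k - a l)).
  apply/matrixP => i k; rewrite !mxE.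
  transitivity ((\prod_(l | l != k) ('X - (a l)%:P)).[a i]).
    rewrite (@horner_coef_wide _ n); last first.
      rewrite -big_filter size_prod_XsubC -sum1_size big_filter sum1_card.
      by rewrite cardC1 card_ord prednK ?(leq_ltn_trans _ (ltn_ord k)).
    by apply: eq_bigr => j _; rewrite !mxE mulrC.
  rewrite horner_prod; under eq_bigr do rewrite hornerXsubC.
  have [->|ik] := eqVneq i k; first by rewrite mulr1n.
  by rewrite (bigD1 i) //= subrr mul0r mulr0n.
have detV : \det V = \prod_(i < n) \prod_(j < n | (i < j)%N) (a j - a i).
  rewrite det_tr det_Vandermonde.
  by apply: eq_bigr => i _; apply: eq_bigr => j _; rewrite !mxE.
have detV0 : \det V != 0.
  rewrite detV; apply/prodf_neq0 => i _; apply/prodf_neq0 => j ij.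
  by rewrite subr_eq0; apply/eqP => /a_inj ji; rewrite ji ltnn in ij.
apply: (mulfI detV0); rewrite -det_mulmx VE det_diag detV.
under eq_bigr do rewrite mxE.
(* In the product over all pairs [l != k], the pairs with [l < k] give [\det V] and those with
   [k < l] give the right-hand side. *)
rewrite (eq_bigr (fun k : 'I_n =>
    \prod_(l < n | (l < k)%N) (a k - a l) * \prod_(l < n | (k < l)%N) (a k - a l))).
  by rewrite big_split /= (exchange_big_dep predT).
move=> k _; rewrite (bigID (fun l : 'I_n => (l < k)%N)) /=; congr (_ * _).
  by apply: eq_bigl => l; rewrite andbC -(inj_eq val_inj) /=; case: ltngtP.
by apply: eq_bigl => l; rewrite -(inj_eq val_inj) /= -leqNgt; case: ltngtP.
Qed.

End VandermondeInverse.

Lemma hominus_var0E n i l k :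
  hominus 0 << SymX k >> (sumA l - sumB i + sumB n)
    * \prod_(1 <= m < n.+1) (1 - beta_ m * x_ k) =
  \prod_(1 <= m < i.+1) (1 - beta_ m * x_ k)
    / \prod_(1 <= m < l.+1) (1 - alpha_ m * x_ k).
Proof.
have betaE m Z : hominus 0 << SymX k >> (Z - sumB m) =
    \prod_(1 <= b < m.+1) (1 - beta_ b * x_ k) * hominus 0 << SymX k >> Z.
  exact: (hominus_var0_sub _ SymBeta).
have alphaE : \prod_(1 <= m < l.+1) (1 - alpha_ m * x_ k)
    * hominus 0 << SymX k >> (sumA l) = 1.
  by rewrite -(hominus_var0_sub _ SymAlpha) subrr hominus_var00.
(* Multiplying by the product over [B_n] removes [B_n] again, and [- sumB i] supplies the
   numerator. *)
rewrite mulrC -betaE addrK betaE; congr (_ * _).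
have alphaU : \prod_(1 <= m < l.+1) (1 - alpha_ m * x_ k) \is a GRing.unit.
  by apply/unitrPr; exists (hominus 0 << SymX k >> (sumA l)).
by rewrite -[LHS](mulKr alphaU) alphaE mulr1.
Qed.

Lemma x_inj : injective x_.
Proof.
move=> i j /mpseriesP/(_ (ucm (SymX i))) /=; rewrite eqxx.
have [/eqP/cmP/(_ (SymX i))|//] := eqVneq (ucm (SymX i)) (ucm (SymX j)).
by rewrite !cmU eqxx; case: eqP => [[]|].
Qed.

(** * Factorization of the determinants *)

Section Factorization.
Variables (n : nat) (a : nat -> nat).

Let W (i : nat) := sumA (a i) - sumB i + sumB n.
Let N : 'M[series]_n := \matrix_(i, j)
  hominus ((a i)%:Z - i.+1%:Z + j.+1%:Z) (sumX n) (W i).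

Lemma det_sumB_col :
  \det (\matrix_(i < n, j < n) hominus ((a i)%:Z - i.+1%:Z + j.+1%:Z) (sumX n)
    (sumA (a i) - sumB i + sumB j.+1)) = \det N.
Proof.
(* Column [j] needs [B_(j+1)], which is [B_n] without [beta_(j+2)], ..., [beta_n]. *)
pose p (j : nat) : {poly series} :=
  \prod_(b <- index_iota j.+1 n) (1 - (beta_ b.+1)%:P * 'X).
(* ['X^j] encodes the column's index offset. The degree of ['X^j * p j] is below [n], so no
   coefficient is lost, and the constant term 1 of [p j] makes [U] unitriangular. *)
pose U : 'M[series]_n := \matrix_(l, j) ('X^j * p j)`_l.
have sizep j : (size (p j) <= (n - j.+1).+1)%N.
  rewrite -(size_iota j.+1 (n - j.+1)) /p /index_iota.
  elim: (iota _ _) => [|b r IHr]; first by rewrite big_nil size_poly1.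
  rewrite big_cons (leq_trans (size_polyMleq _ _)) //=.
  have size2 : (size (1 - (beta_ b.+1)%:P * 'X)%R <= 2)%N.
    rewrite (leq_trans (size_polyD _ _)) // size_poly1 size_polyN geq_max /=.
    by rewrite mul_polyC (leq_trans (size_scale_leq _ _)) // size_polyX.
  by rewrite -subn1 leq_subLR; exact: leq_add size2 IHr.
have detU : \det U = 1.
  rewrite det_trig; last first.
    by apply/is_trig_mxP => l j lj; rewrite mxE coefXnM lj.
  apply: big1 => j _; rewrite mxE coefXnM ltnn subnn -horner_coef0 horner_prod.
  have horner1 (c : series) : (1 - c%:P * 'X).[0] = 1.
    by rewrite hornerD hornerN hornerCM hornerX hornerC mulr0 subr0.
  apply: big1 => b _; apply: horner1.
rewrite -[RHS]mulr1 -detU -det_mulmx; congr (\det _); apply/matrixP => i j.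
rewrite !mxE.
have -> : sumA (a i) - sumB i + sumB j.+1 =
    W i - \sum_(b <- index_iota j.+1 n) << SymBeta b.+1 >>.
  rewrite /W; have -> : sumB n =
      sumB j.+1 + \sum_(b <- index_iota j.+1 n) << SymBeta b.+1 >>.
    rewrite /sumB [LHS](@big_cat_nat _ _ _ j.+2) ?ltnS //.
    by apply: congr2 => //; rewrite big_add1.
  by rewrite addrA addrK.
rewrite (hominus_subr _ (fun b => SymBeta b.+1)).
have -> : (a i)%:Z - i.+1%:Z + j.+1%:Z = (a i)%:Z - i%:Z + j%:Z by lia.
rewrite -shiftactXnM (shiftactE n); last first.
  rewrite (leq_trans (size_polyMleq _ _)) // size_polyXn.
  by rewrite addSn -leq_subRL ?(ltnW (ltn_ord j)) // -subnSK //; exact: sizep.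
apply: eq_bigr => l _; rewrite !mxE mulrC.
by have -> : (a i)%:Z - i.+1%:Z + l.+1%:Z = (a i)%:Z - i%:Z + l%:Z by lia.
Qed.

Lemma det_hominus_var :
  \det (\matrix_(i < n, k < n) hominus (a i + n - i.+1)%N << SymX k.+1 >> (W i)) =
  \det N * \prod_(i < n) \prod_(j < n | (i < j)%N) (x_ i.+1 - x_ j.+1).
Proof.
rewrite -(det_lagrange_coefs _ _ (fun i : 'I_n => x_ i.+1)); last first.
  by move=> i j /x_inj [] /ord_inj.
rewrite -det_mulmx; congr (\det _); apply/matrixP => i k; rewrite !mxE.
pose r := [seq l : 'I_n <- index_enum 'I_n | l != k].
have sizer : (size r).+1 = n.
  rewrite -sum1_size big_filter sum1_card.
  by rewrite cardC1 card_ord prednK ?(leq_ltn_trans _ (ltn_ord k)).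
have -> : << SymX k.+1 >> = sumX n - \sum_(l <- r) << SymX l.+1 >>.
  by rewrite /sumX big_add1 big_mkord big_filter (bigD1 k) //= addrK.
(* The subtraction is exact since [i < n]; the excess over [a i - i] is [n - 1], the number of
   removed letters, as [hominus_subl] requires. *)
have -> : (a i + n - i.+1)%N%:Z = (a i)%:Z - i%:Z + (size r)%:Z.
  by move: (ltn_ord i); lia.
rewrite (hominus_subl _ (fun l : 'I_n => SymX l.+1)) (shiftactE n); last first.
  by rewrite size_prod_XsubC sizer.
apply: eq_bigr => j _; rewrite !mxE mulrC big_filter.
by have -> : (a i)%:Z - i.+1%:Z + j.+1%:Z = (a i)%:Z - i%:Z + j%:Z by lia.
Qed.

Lemma det_numerator :
  \det (\matrix_(i < n, j < n)
     (x_ j.+1 ^+ (a i + n - i.+1)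
      * \prod_(1 <= k < i.+1) (1 - beta_ k * x_ j.+1)
      / \prod_(1 <= k < (a i).+1) (1 - alpha_ k * x_ j.+1))) =
  prefactor n * \det (\matrix_(i < n, j < n)
    hominus ((a i)%:Z - i.+1%:Z + j.+1%:Z) (sumX n)
      (sumA (a i) - sumB i + sumB j.+1))
  * \prod_(i < n) \prod_(j < n | (i < j)%N) (x_ i.+1 - x_ j.+1).
Proof.
rewrite det_sumB_col -mulrA -det_hominus_var mulrC.
(* [C_n] is the determinant of the column scaling that cancels the denominators coming from
   [B_n]. *)
have -> : prefactor n = \det (diag_mx
    (\row_(k < n) \prod_(1 <= i < n.+1) (1 - beta_ i * x_ k.+1))).
  rewrite det_diag /prefactor exchange_big big_add1 big_mkord.
  by apply: eq_bigr => k _; rewrite mxE.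
rewrite -det_mulmx mul_mx_diag; congr (\det _); apply/matrixP => i k.
by rewrite !mxE hominus_var -[RHS]mulrA hominus_var0E mulrA.
Qed.

End Factorization.

Theorem theorem5p2 (n : nat) (lam : seq nat)
  (lam_part : is_partition lam) (lam_size : (size lam <= n)%N) :
  Groth n lam =
  (prefactor n *
   \det (\matrix_(i < n, j < n)
     hominus ((part lam i.+1)%:Z - i.+1%:Z + j.+1%:Z) (sumX n)
       (sumA (part lam i.+1) - sumB i + sumB j.+1)))%:F.
Proof.
rewrite /Groth (det_numerator n (fun i => part lam i.+1)) tofracM mulfK //.
rewrite tofrac_eq0; apply/prodf_neq0 => i _; apply/prodf_neq0 => j ij.
by rewrite subr_eq0; apply/eqP => /x_inj [] ji; rewrite ji ltnn in ij.
Qed.
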